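(* Let $\mathbf{M}$ be a weight sequence satisfying (lc) and (dc) and let $\mathbf{A}$ be a weight sequence satisfying (wlc) and (nq). Then none of the Stieltjes moment mappings $\mathcal{M}:C_{\mathbf{M}}[0,\infty)\to\Lambda_{\mathbf{M}}$, $\mathcal{M}:\mathcal{S}_{\mathbf{M}}(0,\infty)\to\Lambda_{\mathbf{M}}$ and $\mathcal{M}:\mathcal{S}_{\mathbf{M}}^{\mathbf{A}}(0,\infty)\to\Lambda_{\mathbf{M}}$ is bijective.
   Context: $\mathbb{N}=\{0,1,2,\dots\}$. A sequence $\mathbf{M}=(M_p)_{p\in\mathbb{N}}$ of positive reals with $M_0=1$ is a weight sequence if $m_p:=M_{p+1}/M_p\to\infty$ as $p\to\infty$. Conditions on a sequence $\mathbf{M}$ of positive reals with $M_0=1$ (applied to $\mathbf{A}$ with $A_p$, $a_p=A_{p+1}/A_p$ in place of $M_p$, $m_p$): (lc) $M_p^2\le M_{p-1}M_{p+1}$ for all $p\ge 1$; (wlc) the sequence $(p!M_p)_{p}$ satisfies (lc); (dc) there are $C_0,H\ge1$ with $M_{p+1}\le C_0H^{p+1}M_p$ for all $p\in\mathbb{N}$; (nq) $\sum_{p=0}^\infty \frac{1}{(p+1)m_p}<\infty$. Spaces: $\Lambda_{\mathbf{M}}$ is the space of complex sequences $(c_p)_{p\in\mathbb{N}}$ for which there is $h>0$ with $\sup_{p}\frac{|c_p|}{h^pp!M_p}<\infty$. $C_{\mathbf{M}}[0,\infty)$ is the space of $\varphi\in C([0,\infty))$ (complex-valued) for which there is $h>0$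 with $\sup_{p\in\mathbb{N}}\sup_{x\ge0}\frac{x^p|\varphi(x)|}{h^pp!M_p}<\infty$. $\mathcal{S}_{\mathbf{M}}(0,\infty)$ is the space of $\varphi\in C^\infty(\mathbb{R})$ with $\operatorname{supp}\varphi\subseteq[0,\infty)$ for which there is $h>0$ such that for all $q\in\mathbb{N}$, $\sup_{p\in\mathbb{N}}\sup_{x\in\mathbb{R}}\frac{|x^p\varphi^{(q)}(x)|}{h^pp!M_p}<\infty$. $\mathcal{S}_{\mathbf{M}}^{\mathbf{A}}(0,\infty)$ is the space of $\varphi\in C^\infty(\mathbb{R})$ with $\operatorname{supp}\varphi\subseteq[0,\infty)$ for which there is $h>0$ with $\sup_{p,q\in\mathbb{N}}\sup_{x\in\mathbb{R}}\frac{|x^p\varphi^{(q)}(x)|}{h^{p+q}p!M_pq!A_q}<\infty$. The last two spaces are viewed as subspaces of $C_{\mathbf{M}}[0,\infty)$ by restriction to $[0,\infty)$. The Stieltjes moment mapping is $\mathcal{M}(\varphi)=(\mu_p(\varphi))_{p\in\mathbb{N}}$ with $\mu_p(\varphi)=\int_0^\infty x^p\varphi(x)\,dx$; it takes values in $\Lambda_{\mathbf{M}}$ because $\mathbf{M}$ satisfies (dc). *)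

(* Defs.v *)
From HB Require Import structures.
From mathcomp Require Import all_boot all_order all_algebra.
From mathcomp Require Import all_classical all_reals all_analysis.
From mathcomp Require Import complex.

Set Implicit Arguments.
Unset Strict Implicit.
Unset Printing Implicit Defensive.

Import Order.TTheory GRing.Theory Num.Theory.
Import numFieldNormedType.Exports.

Local Open Scope classical_set_scope.
Local Open Scope ring_scope.

(* [Rcomplex R] is the field R[i] of complex numbers, seen as a real vector
   space with the R-valued modulus as norm. The library stops at the normed
   Z-module structure; with the topology of the modulus added here, continuity
   and derivatives of functions R -> Rcomplex R are the library's. *)
Lemma Rcomplex_normrZ (R : realType) (l : R) (z : Rcomplex R) :
  `|l *: z| = `|l| * `|z|.
Proof.
case: z => a b; rewrite -(sqrtr_sqr l).
rewrite -[LHS]/(Num.sqrt ((l * a) ^+ 2 + (l * b) ^+ 2)).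
rewrite -[X in _ = _ * X]/(Num.sqrt (a ^+ 2 + b ^+ 2)).
by rewrite -sqrtrM ?sqr_ge0// mulrDr !exprMn.
Qed.

Section RcomplexNormedModule.
Variable R : realType.

HB.instance Definition _ :=
  PseudoMetric.copy (Rcomplex R) (pseudoMetric_normed (Rcomplex R)).
HB.instance Definition _ := isPointed.Build (Rcomplex R) 0.
HB.instance Definition _ :=
  NormedZmod_PseudoMetric_eq.Build R (Rcomplex R) erefl.
HB.instance Definition _ :=
  PseudoMetricNormedZmod_Lmodule_isNormedModule.Build R (Rcomplex R)
    (@Rcomplex_normrZ R).

End RcomplexNormedModule.

Section Sequences.
Variable R : realType.
Implicit Type M : nat -> R.

Definition quotient_seq M (p : nat) : R := M p.+1 / M p.

Definition weight_sequence M : Prop :=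
  [/\ M 0%N = 1, forall p, 0 < M p & quotient_seq M @ \oo --> +oo].

Definition lc M : Prop :=
  forall p, (1 <= p)%N -> M p ^+ 2 <= M p.-1 * M p.+1.

Definition wlc M : Prop := lc (fun p => p`!%:R * M p).

Definition dc M : Prop :=
  exists C0 H : R,
    [/\ 1 <= C0, 1 <= H & forall p, M p.+1 <= C0 * H ^+ p.+1 * M p].

Definition nq M : Prop :=
  (\sum_(0 <= p <oo) ((p.+1%:R * quotient_seq M p)^-1)%:E < +oo)%E.

End Sequences.

Section Spaces.
Variable R : realType.
Implicit Types (M A : nat -> R) (phi : R -> Rcomplex R).

Definition Lambda M : set (nat -> Rcomplex R) :=
  [set c | exists2 h : R, 0 < h &
    has_ubound [set y | exists p, y = `|c p| / (h ^+ p * p`!%:R * M p)]].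

(* A function on [0,oo) is represented by its extension by zero to R, so that
   equality of representatives is equality on [0,oo), and restricting to [0,oo)
   a function supported in [0,oo) does not change its representative. *)
Definition C_space M : set (R -> Rcomplex R) :=
  [set phi : R -> Rcomplex R | [/\ forall x, x < 0 -> phi x = 0,
    {within `[0, +oo[, continuous phi} &
    exists2 h : R, 0 < h &
      has_ubound [set y | exists p x, 0 <= x /\
        y = x ^+ p * `|phi x| / (h ^+ p * p`!%:R * M p)]]].

Definition smooth phi : Prop := forall q x, derivable (derive1n q phi) x 1.

Definition supp phi : set R := closure [set x | phi x != 0].

Definition S_space M : set (R -> Rcomplex R) :=
  [set phi : R -> Rcomplex R | [/\ smooth phi, supp phi `<=` `[0, +oo[ &
    exists2 h : R, 0 < h & forall q,
      has_ubound [set y | exists p x,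
        y = `|x ^+ p *: derive1n q phi x| / (h ^+ p * p`!%:R * M p)]]].

Definition SA_space M A : set (R -> Rcomplex R) :=
  [set phi : R -> Rcomplex R | [/\ smooth phi, supp phi `<=` `[0, +oo[ &
    exists2 h : R, 0 < h &
      has_ubound [set y | exists p q x,
        y = `|x ^+ p *: derive1n q phi x|
            / (h ^+ (p + q) * p`!%:R * M p * q`!%:R * A q)]]].

(* The library's Lebesgue integral is real-valued; a complex-valued function is
   integrated componentwise. *)
Definition Cintegral (D : set R) (f : R -> Rcomplex R) : Rcomplex R :=
  Complex (\int[lebesgue_measure]_(x in D) complex.Re (f x))
          (\int[lebesgue_measure]_(x in D) complex.Im (f x)).

Definition stieltjes_moment phi (p : nat) : Rcomplex R :=
  Cintegral `[0, +oo[ (fun x => x ^+ p *: phi x).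

End Spaces.

(* Main.v *)
(* If a moment mapping were bijective, some phi in the space would have the
   moment sequence (0, 1, 0, 0, ...). By (dc) the space is stable under
   multiplication by x, which shifts the moments, so x^2 phi has the same
   (vanishing) moments as 0. Injectivity gives x^2 phi = 0, hence x phi = 0,
   which contradicts the first moment of phi being 1. *)

Require Import Defs.
From mathcomp Require Import all_boot all_order all_algebra.
From mathcomp Require Import all_classical all_reals all_analysis.
From mathcomp Require Import complex.
From mathcomp Require Import ring lra.

Set Implicit Arguments.
Unset Strict Implicit.
Unset Printing Implicit Defensive.

Import Order.TTheory GRing.Theory Num.Theory.
Import numFieldNormedType.Exports.

Local Open Scope ring_scope.
Local Open Scope classical_set_scope.

(** * Iterated derivatives of the product of a function with the identity *)

Section MulId.
Variables (R : realType) (V : normedModType R).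
Implicit Types f : R -> V.

(** Product rule from the splitting (h + x) f(h + x) - x f(x) = x (f(h + x) - f(x)) + h f(h + x):
    divided by h, the last term tends to f(x) by continuity. *)
Lemma is_derive_scale_id f (x : R) : derivable f x 1 ->
  is_derive x 1 (fun t => t *: f t) (x *: derive1 f x + f x).
Proof.
move=> df.
have fx : f (h + x) @[h --> 0^'] --> f x.
  by apply/continuous_withinNshiftx; exact/differentiable_continuous/derivable1_diffP.
have dq : h^-1 *: (f (h + x) - f x) @[h --> 0^'] --> derive1 f x.
  rewrite derive1E; move: df; rewrite /derivable /derive.
  by under eq_fun do rewrite /= scaler1.
have lim : h^-1 *: (((fun t => t *: f t) \o shift x) (h *: 1) - x *: f x)
    @[h --> 0^'] --> x *: derive1 f x + f x.
  have xdq : x *: (h^-1 *: (f (h + x) - f x)) + f (h + x) @[h --> 0^'] -->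
      x *: derive1 f x + f x.
    by apply: cvgD fx; exact: cvgZl_tmp.
  apply: cvg_trans xdq; apply: near_eq_cvg; near=> h.
  have h0 : h != 0 by near: h; exact: nbhs_dnbhs_neq.
  rewrite /= scaler1 (_ : (h + x) *: f (h + x) - x *: f x =
    x *: (f (h + x) - f x) + h *: f (h + x)).
    by rewrite [RHS]scalerDr !scalerA mulVf// scale1r mulrC.
  by rewrite scalerBr [h + x]addrC scalerDl addrAC.
apply: DeriveDef; first by apply/cvg_ex; exists (x *: derive1 f x + f x).
exact/cvg_lim.
Unshelve. all: by end_near. Qed.

(** Leibniz formula, cut to two terms because the second derivative of the identity vanishes. At q =
    0 the truncated [q.-1] is harmless, its coefficient being 0. *)
Lemma derive1n_scale_id f q x : (forall k t, derivable (derive1n k f) t 1) ->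
  derive1n q (fun t => t *: f t) x = x *: derive1n q f x + q%:R *: derive1n q.-1 f x.
Proof.
move=> df; elim: q x => [|q IH] x; first by rewrite /= scale0r addr0.
rewrite derive1nS (_ : derive1n q _ =
  fun t => t *: derive1n q f t + q%:R *: derive1n q.-1 f t); last exact/funext.
have d1 := is_derive_scale_id (df q x).
have d2 : is_derive x 1 (fun t => q%:R *: derive1n q.-1 f t) (q%:R *: derive1n q f x).
  (* For q = 0 the orders [q.-1] and q coincide, so this case rests on the zero coefficient instead:
     the function is constant. *)
  case: q {IH d1} => [|q] /=.
    under eq_fun do rewrite scale0r.
    by rewrite scale0r; exact: is_derive_cst.
  have dq : is_derive x 1 (derive1n q f) (derive1n q.+1 f x).
    by rewrite derive1nS derive1E; exact/derivableP.
  exact: is_deriveZ.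
rewrite derive1E; have [_ ->] := is_deriveD d1 d2.
by rewrite -addrA -[in RHS]nat1r scalerDl scale1r.
Qed.

Lemma derivable_derive1n_scale_id f : (forall k t, derivable (derive1n k f) t 1) ->
  forall q x, derivable (derive1n q (fun t => t *: f t)) x 1.
Proof.
move=> df q x.
rewrite (_ : derive1n q _ =
  fun t => t *: derive1n q f t + q%:R *: derive1n q.-1 f t); last first.
  by apply/funext => t; exact: derive1n_scale_id.
apply: derivableD; last exact: derivableZ.
by have [] := is_derive_scale_id (df q x).
Qed.

Lemma derive1n_cst0 q : derive1n q (fun=> 0 : V) = (fun=> 0) :> (R -> V).
Proof.
by elim: q => // q IH; rewrite derive1nS IH; apply/funext => x; exact: derive1_cst.
Qed.

End MulId.

(** * Reduction to stability under multiplication by x *)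

Section Spaces.
Variable R : realType.
Implicit Types (M A : nat -> R) (phi : R -> Rcomplex R).

(** Stated for an abstract V so that one argument serves all three spaces. *)
Lemma not_set_bij_stieltjes_moment M (V : set (R -> Rcomplex R)) :
  (forall p, 0 < M p) -> V (fun=> 0) ->
  (forall phi, V phi -> V (fun x => x *: phi x)) ->
  ~ set_bij V (Lambda M) (@stieltjes_moment R).
Proof.
move=> M0 V0 VX [_ inj surj].
have Le1 : Lambda M (fun p => (p == 1%N)%:R : Rcomplex R).
  (* With h = 1 the only nonzero quotient is the one at p = 1, and it equals this bound. *)
  exists 1 => //; exists (`|1 : Rcomplex R| / M 1%N) => _ [p ->].
  case: (eqVneq p 1%N) => [->|_] /=.
    by rewrite !mul1r.
  by rewrite normr0 mul0r divr_ge0// ltW.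
have [phi Vphi mphi] := surj _ Le1.
have m0 p : stieltjes_moment (fun=> 0 : Rcomplex R) p = 0.
  rewrite /stieltjes_moment.
  have -> : (fun x => x ^+ p *: (0 : Rcomplex R)) = (fun=> 0).
    by apply/funext => x; rewrite scaler0.
  by rewrite /Cintegral /= !Rintegral_cst ?mul0r//; exact: measurable_itv.
have X0 : (fun x => x *: (x *: phi x)) = (fun=> 0 : Rcomplex R).
  apply: inj; rewrite ?inE//; first exact: VX (VX _ Vphi).
  apply/funext => p; rewrite m0.
  have -> : stieltjes_moment (fun x => x *: (x *: phi x)) p = stieltjes_moment phi p.+2.
    rewrite /stieltjes_moment; congr Cintegral; apply/funext => x.
    by rewrite !scalerA -!exprSr.
  by rewrite mphi.
(* At x = 0 nothing is learnt about [phi 0], but the product still vanishes; this is why the moment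
   of order 1, not 0, was prescribed to be nonzero. *)
have xphi x : x *: phi x = 0.
  have /eqP := congr1 (@^~ x) X0.
  by rewrite scaler_eq0 => /orP[/eqP ->|/eqP//]; rewrite scale0r.
have : stieltjes_moment phi 1 = stieltjes_moment (fun=> 0 : Rcomplex R) 0.
  rewrite /stieltjes_moment; congr Cintegral; apply/funext => x.
  by rewrite expr1 xphi scaler0.
by rewrite m0 mphi => /eqP; rewrite oner_eq0.
Qed.

(** * Stability of the three spaces under multiplication by x *)

Lemma dc_weight_shift M : (forall p, 0 < M p) -> dc M ->
  exists B D : R, [/\ 1 <= B, 0 <= D & forall h p, 0 < h ->
    h ^+ p.+1 * p.+1`!%:R * M p.+1 <= h * D * ((B * h) ^+ p * p`!%:R * M p)].
Proof.
(* The factor 2 H absorbs p + 1 <= 2^p, coming from (p + 1)!, and H^p from (dc). The leftover C H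
   becomes D, and the leftover h stays explicit, so neither constant depends on h. *)
move=> M0 [C [H [C1 H1 HM]]]; exists (2 * H), (C * H); split.
- lra.
- by rewrite mulr_ge0//; lra.
move=> h p h0.
have p2 : (p.+1)%:R <= 2 ^+ p :> R by rewrite -natrX ler_nat ltn_expl.
rewrite factS natrM.
have -> : h ^+ p.+1 * (p.+1%:R * p`!%:R) * M p.+1
    = (h ^+ p.+1 * p`!%:R) * (p.+1%:R * M p.+1) by ring.
have -> : h * (C * H) * ((2 * H * h) ^+ p * p`!%:R * M p) =
   (h ^+ p.+1 * p`!%:R) * (2 ^+ p * (C * H ^+ p.+1 * M p)).
  by rewrite !exprMn !exprS; ring.
apply: ler_wpM2l; first by rewrite mulr_ge0// exprn_ge0// ltW.
by apply: ler_pM => //; rewrite ltW.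
Qed.

Lemma weight_gt0 M h p : (forall p, 0 < M p) -> 0 < h ->
  0 < h ^+ p * p`!%:R * M p.
Proof.
by move=> M0 h0; rewrite !mulr_gt0// ?exprn_gt0// ltr0n fact_gt0.
Qed.

(** Replaces monotonicity of A, which may fail for small indices. It turns the A_(q-1) produced by
    the lower-order Leibniz term into A_q. *)
Lemma weight_sequence_le_mulS A : weight_sequence A ->
  exists2 L, 0 <= L & forall p, A p <= L * A p.+1.
Proof.
case=> _ A0 /cvgryPge/(_ 1)[N _ AN].
(* The 1 serves the p >= N, where the quotients of A are at least 1; each p < N is served by its own
   summand. *)
exists (1 + \sum_(k < N) A k / A k.+1) => [|p].
  by rewrite addr_ge0// sumr_ge0// => k _; rewrite divr_ge0// ltW.
rewrite -ler_pdivrMr//; have [Np|pN] := leqP N p.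
  rewrite (@le_trans _ _ 1)//; last first.
    by rewrite lerDl sumr_ge0// => k _; rewrite divr_ge0// ltW.
  by have := AN p Np; rewrite /quotient_seq/= ler_pdivlMr// mul1r ler_pdivrMr// mul1r.
rewrite (bigD1 (Ordinal pN))//= addrCA lerDl addr_ge0// sumr_ge0// => k _.
by rewrite divr_ge0// ltW.
Qed.

Lemma C_space_scale_id M phi : (forall p, 0 < M p) -> dc M ->
  C_space M phi -> C_space M (fun x => x *: phi x).
Proof.
move=> M0 /(dc_weight_shift M0)[B [D [B1 D0 HM]]] [phi0 cphi [h h0 [K ubK]]].
have Bh0 : 0 < B * h by rewrite mulr_gt0//; lra.
have phiK p x : 0 <= x -> x ^+ p * `|phi x| <= K * (h ^+ p * p`!%:R * M p).
  by move=> x0; rewrite -ler_pdivrMr ?weight_gt0//; apply: ubK; exists p, x.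
(* K is only some upper bound; its sign is read off the estimate at p = 0, x = 0. *)
have K0 : 0 <= K.
  rewrite -(pmulr_lge0 _ (weight_gt0 0 M0 h0)).
  by rewrite (le_trans _ (phiK 0%N 0 (lexx 0)))// mul1r.
split.
- by move=> x /phi0 ->; rewrite scaler0.
- move=> x; apply: continuousZ; last exact: cphi.
  by apply: continuous_subspaceT => y; exact: cvg_id.
exists (B * h) => //; exists (K * (h * D)) => _ [p [x [x0 ->]]].
rewrite ler_pdivrMr ?weight_gt0// normrZ ger0_norm// mulrA -exprSr.
rewrite (le_trans (phiK p.+1 x x0))// -[leRHS]mulrA ler_wpM2l//.
exact: HM.
Qed.

Lemma supp_scale_id phi : supp (fun x => x *: phi x) `<=` supp phi.
Proof.
by apply: closure_subset => x /=; apply: contra => /eqP ->; rewrite scaler0.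
Qed.

Lemma norm_derive1n_scale_id phi p q x : smooth phi ->
  `|x ^+ p *: derive1n q (fun t => t *: phi t) x| <=
  `|x ^+ p.+1 *: derive1n q phi x| + q%:R * `|x ^+ p *: derive1n q.-1 phi x|.
Proof.
move=> sphi; rewrite derive1n_scale_id// scalerDr scalerA -exprSr.
rewrite scalerA mulrC -scalerA (le_trans (ler_normD _ _))//.
by rewrite [X in _ + X]normrZ normr_nat.
Qed.

Lemma S_space_scale_id M phi : (forall p, 0 < M p) -> dc M ->
  S_space M phi -> S_space M (fun x => x *: phi x).
Proof.
move=> M0 /(dc_weight_shift M0)[B [D [B1 D0 HM]]] [sphi supphi [h h0 ub]].
have Bh0 : 0 < B * h by rewrite mulr_gt0//; lra.
split.
- exact: derivable_derive1n_scale_id.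
- exact: subset_trans (@supp_scale_id phi) supphi.
exists (B * h) => // q.
have bound q' : exists2 K, 0 <= K & forall p x,
    `|x ^+ p *: derive1n q' phi x| <= K * (h ^+ p * p`!%:R * M p).
  have [K ubK] := ub q'; have phiK p x :
      `|x ^+ p *: derive1n q' phi x| <= K * (h ^+ p * p`!%:R * M p).
    by rewrite -ler_pdivrMr ?weight_gt0//; apply: ubK; exists p, x.
  exists K => //; rewrite -(pmulr_lge0 _ (weight_gt0 0 M0 h0)).
  exact: le_trans (phiK 0%N 0).
have [K K0 phiK] := bound q; have [L L0 phiL] := bound q.-1.
(* The order-q term pays for the shift from p + 1 to p; the other one only needs h <= B h. The
   constant may depend on q, the parameter B h may not. *)
exists (K * (h * D) + q%:R * L) => _ [p [x ->]].
rewrite ler_pdivrMr ?weight_gt0// (le_trans (norm_derive1n_scale_id _ _ _ sphi))//.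
rewrite mulrDl lerD//.
  rewrite (le_trans (phiK p.+1 x))// -[leRHS]mulrA ler_wpM2l//; exact: HM.
rewrite -[leRHS]mulrA ler_wpM2l// (le_trans (phiL p x))// ler_wpM2l//.
rewrite ler_wpM2r ?(ltW (M0 _))// ler_wpM2r//.
by apply: lerXn2r; rewrite ?nnegrE ?ler_pMl// ltW.
Qed.

(** Here one constant must serve all q, so the Leibniz coefficient q has to go into the weight,
    through q (q - 1)! = q!. *)
Lemma SA_space_scale_id M A phi : (forall p, 0 < M p) -> dc M ->
  weight_sequence A ->
  SA_space M A phi -> SA_space M A (fun x => x *: phi x).
Proof.
move=> M0 /(dc_weight_shift M0)[B [D [B1 D0 HM]]] wA [sphi supphi [h h0 [K ubK]]].
have [_ A0 _] := wA.
have [L L0 AL] := weight_sequence_le_mulS wA.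
have Bh0 : 0 < B * h by rewrite mulr_gt0//; lra.
have w0 k (p q : nat) : 0 < k -> 0 < k ^+ (p + q) * p`!%:R * M p * q`!%:R * A q.
  by move=> k0; rewrite !mulr_gt0// ?exprn_gt0// ltr0n fact_gt0.
have phiK p q x : `|x ^+ p *: derive1n q phi x| <=
    K * (h ^+ (p + q) * p`!%:R * M p * q`!%:R * A q).
  by rewrite -ler_pdivrMr ?w0//; apply: ubK; exists p, q, x.
have K0 : 0 <= K.
  rewrite -(pmulr_lge0 _ (w0 h 0%N 0%N h0)).
  exact: le_trans (phiK 0%N 0%N 0).
split.
- exact: derivable_derive1n_scale_id.
- exact: subset_trans (@supp_scale_id phi) supphi.
exists (B * h) => //.
(* In the second summand [h^-1] compensates the missing power of h at order q - 1, and L the step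
   from A_(q-1) to A_q. *)
exists (K * (h * D) + K * (h^-1 * L)) => _ [p [q [x ->]]].
rewrite ler_pdivrMr ?w0// (le_trans (norm_derive1n_scale_id _ _ _ sphi))//.
have hBh n : h ^+ n <= (B * h) ^+ n.
  by apply: lerXn2r; rewrite ?nnegrE ?ler_pMl// ltW.
rewrite mulrDl lerD//.
  rewrite (le_trans (phiK p.+1 q x))// -[leRHS]mulrA ler_wpM2l//.
  have -> : h ^+ (p.+1 + q) * p.+1`!%:R * M p.+1 * q`!%:R * A q =
      h ^+ p.+1 * p.+1`!%:R * M p.+1 * (h ^+ q * q`!%:R * A q).
    by rewrite exprD; ring.
  have -> : h * D * ((B * h) ^+ (p + q) * p`!%:R * M p * q`!%:R * A q) =
      h * D * ((B * h) ^+ p * p`!%:R * M p) * ((B * h) ^+ q * q`!%:R * A q).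
    by rewrite exprD; ring.
  apply: ler_pM; [exact/ltW/weight_gt0|exact/ltW/weight_gt0|exact: HM|].
  by rewrite ler_wpM2r ?(ltW (A0 _))// ler_wpM2r.
(* At order 0 the lower-order term has coefficient 0, and only nonnegativity of the bound
   remains. *)
case: q => [|q].
  by rewrite mul0r mulr_ge0 ?(ltW (w0 _ _ _ Bh0))// !mulr_ge0 ?invr_ge0 ?(ltW h0).
rewrite (le_trans (ler_wpM2l _ (phiK p q x)))//=.
rewrite mulrCA -[leRHS]mulrA ler_wpM2l// factS natrM.
have -> : q.+1%:R * (h ^+ (p + q) * p`!%:R * M p * q`!%:R * A q) =
    h^-1 * (p`!%:R * M p * (q.+1%:R * q`!%:R)) * (h ^+ (p + q.+1) * A q).
  by rewrite addnS exprS; field; rewrite gt_eqF.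
have -> : h^-1 * L *
    ((B * h) ^+ (p + q.+1) * p`!%:R * M p * (q.+1%:R * q`!%:R) * A q.+1) =
    h^-1 * (p`!%:R * M p * (q.+1%:R * q`!%:R)) *
    ((B * h) ^+ (p + q.+1) * (L * A q.+1)) by ring.
apply: ler_wpM2l; first by rewrite !mulr_ge0 ?invr_ge0 ?(ltW h0) ?(ltW (M0 _)).
by apply: ler_pM; rewrite ?hBh ?AL ?exprn_ge0 ?(ltW h0) ?(ltW (A0 _)).
Qed.

(** * The zero function belongs to the three spaces *)

Lemma C_space0 M : C_space M (fun=> 0).
Proof.
split => //; first exact: cst_continuous.
by exists 1 => //; exists 0 => _ [p [x [_ ->]]]; rewrite normr0 mulr0 mul0r.
Qed.

Lemma smooth0 : smooth (fun=> 0 : Rcomplex R).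
Proof. by move=> q x; rewrite derive1n_cst0; exact: derivable_cst. Qed.

Lemma supp0 : supp (fun=> 0 : Rcomplex R) = set0.
Proof.
by rewrite /supp (_ : [set _ | _] = set0) ?closure0// -subset0 => x /=; rewrite eqxx.
Qed.

Lemma S_space0 M : S_space M (fun=> 0).
Proof.
split; [exact: smooth0|by rewrite supp0|exists 1 => // q; exists 0 => _ [p [x ->]]].
by rewrite derive1n_cst0 scaler0 normr0 mul0r.
Qed.

Lemma SA_space0 M A : SA_space M A (fun=> 0).
Proof.
split; [exact: smooth0|by rewrite supp0|exists 1 => //; exists 0 => _ [p [q [x ->]]]].
by rewrite derive1n_cst0 scaler0 normr0 mul0r.
Qed.

End Spaces.

Theorem corollary3p7 (R : realType) (M A : nat -> R)
  (hM : weight_sequence M) (hMlc : lc M) (hMdc : dc M)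
  (hA : weight_sequence A) (hAwlc : wlc A) (hAnq : nq A) :
  [/\ ~ set_bij (C_space M) (Lambda M) (@stieltjes_moment R),
      ~ set_bij (S_space M) (Lambda M) (@stieltjes_moment R) &
      ~ set_bij (SA_space M A) (Lambda M) (@stieltjes_moment R)].
Proof.
have [_ M0 _] := hM.
split; apply: not_set_bij_stieltjes_moment => //.
- exact: C_space0.
- by move=> phi; exact: C_space_scale_id.
- exact: S_space0.
- by move=> phi; exact: S_space_scale_id.
- exact: SA_space0.
- by move=> phi; exact: SA_space_scale_id.
Qed.
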